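(* Let $\psi_{AB}$ be a pure bipartite state on $\mathcal{H}_A\otimes\mathcal{H}_B$ and let $\rho_B:=\operatorname{Tr}_A[\psi_{AB}]$. If $\rho_B$ is not a pure state, then the acceptance probability $p^{(k)}$ of the bipartite pure-state separability test is strictly decreasing in $k$, that is, $p^{(k+1)}<p^{(k)}$ for all integers $k\ge 1$, and $\lim_{k\to\infty}p^{(k)}=0$.
   Context: $\mathcal{H}_A,\mathcal{H}_B$ are finite-dimensional complex Hilbert spaces; a pure state is a rank-one projection $|\psi\rangle\langle\psi|$ with $|\psi\rangle$ a unit vector, and $\operatorname{Tr}_A$ is the partial trace over $\mathcal{H}_A$. For $\pi\in S_k$, $W_{B_1\cdots B_k}(\pi)$ is the unitary on $\mathcal{H}_B^{\otimes k}$ permuting the tensor factors: $W_{B_1\cdots B_k}(\pi)(v_1\otimes\cdots\otimes v_k)=v_{\pi^{-1}(1)}\otimes\cdots\otimes v_{\pi^{-1}(k)}$. The acceptance probability of the bipartite pure-state separability test with $k$ copies is $$p^{(k)}:=\operatorname{Tr}[\Pi_{B_1\cdots B_k}\,\rho_B^{\otimes k}],\qquad \Pi_{B_1\cdots B_k}:=\frac{1}{k!}\sum_{\pi\in S_k}W_{B_1\cdots B_k}(\pi).$$ *)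

(* Defs.v *)
From mathcomp Require Import all_boot all_order all_algebra all_fingroup.
From mathcomp Require Export mxtens complex.
From mathcomp Require Import all_classical all_reals all_analysis.
Export numFieldNormedType.Exports.

Set Implicit Arguments.
Unset Strict Implicit.
Unset Printing Implicit Defensive.

Import GRing.Theory Num.Theory.
Local Open Scope ring_scope.

(* An n-dimensional complex Hilbert space with a fixed orthonormal basis is
   'cV[C]_n with inner product <u|v> = adjmx u *m v; operators are matrices. *)
Definition adjmx (C : numClosedFieldType) (m n : nat) (M : 'M[C]_(m, n)) :
  'M[C]_(n, m) := map_mx Num.conj M^T.

Definition pure_state (C : numClosedFieldType) (n : nat) (rho : 'M[C]_n) : Prop :=
  exists v : 'cV[C]_n, adjmx v *m v = 1%:M /\ rho = v *m adjmx v.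

Definition ptraceA (K : pzRingType) (dA dB : nat) (M : 'M[K]_(dA * dB)) :
  'M[K]_dB :=
  \matrix_(i, j) \sum_(a < dA) M (mxtens_index (a, i)) (mxtens_index (a, j)).

Lemma ptraceA_tens (K : pzRingType) (dA dB : nat) (M : 'M[K]_dA) (N : 'M[K]_dB) :
  ptraceA (M *t N) = \tr M *: N.
Proof.
apply/matrixP => i j; rewrite !mxE /mxtrace mulr_suml.
by apply: eq_bigr => a _; rewrite tensmxE.
Qed.

Lemma tens_digit_proof (d k : nat) (i : 'I_(d ^ k)) (l : 'I_k) :
  ((i %/ d ^ (k - l.+1)) %% d < d)%N.
Proof.
rewrite ltn_mod; case: d i => // -[x].
by case: k l => [[]|k l] //; rewrite exp0n.
Qed.

(* The basis of the k-fold tensor power underlying ntensmx is indexed by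
   'I_(d ^ k): i is the vector e_(i_0) (x) ... (x) e_(i_(k-1)), where i_l is
   the l-th base-d digit of i, most significant digit first. *)
Definition tens_digit (d k : nat) (i : 'I_(d ^ k)) (l : 'I_k) : 'I_d :=
  Ordinal (tens_digit_proof i l).

Lemma ntensmxE (K : comPzRingType) (m n k : nat) (A : 'M[K]_(m, n))
    (i : 'I_(m ^ k)) (j : 'I_(n ^ k)) :
  ntensmx A k i j = \prod_(l < k) A (tens_digit i l) (tens_digit j l).
Proof.
case: k i j => [|k] i j.
  by rewrite big_ord0 mxE; case: i j => [[|[]]] //= ? [[|[]]].
elim: k i j => [|k IHk] i j.
  rewrite ntensmx1 big_ord1; congr (A _ _); apply: val_inj => /=;
    by rewrite subnn expn0 divn1 modn_small.
rewrite ntensmxSS mxE IHk [RHS]big_ord_recl; congr (_ * _).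
  congr (A _ _); apply: val_inj => /=; rewrite subSS subn0 modn_small //.
  - by rewrite ltn_divLR ?expn_gt0 -?expnS //; case: (m) i => // -[].
  - by rewrite ltn_divLR ?expn_gt0 -?expnS //; case: (n) j => // -[].
have modE d (x e : nat) :
    (e < k.+1 -> (x %% d ^ k.+1) %/ d ^ e %% d = x %/ d ^ e %% d)%N.
  move=> le_ek; rewrite -(subnK (leqW le_ek : (e <= k.+1)%N)) expnD -modn_divl.
  by rewrite modn_dvdm // dvdn_exp // subn_gt0.
apply: eq_bigr => l _; congr (A _ _); apply: val_inj => /=;
  by rewrite /bump /= add1n [in RHS]subSS modE // ltnS subSS leq_subr.
Qed.

Definition tensv (K : pzRingType) (d k : nat) (v : 'I_k -> 'cV[K]_d) :
  'cV[K]_(d ^ k) :=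
  \col_i \prod_(l < k) v l (tens_digit i l) 0.

Definition tens_perm (K : pzRingType) (d k : nat) (s : 'S_k) : 'M[K]_(d ^ k) :=
  \matrix_(i, j) [forall l, tens_digit i l == tens_digit j (s^-1%g l)]%:R.

Lemma tens_digit_inj (d k : nat) (i j : 'I_(d ^ k)) :
  (forall l, tens_digit i l = tens_digit j l) -> i = j.
Proof.
move=> eq_ij; apply: val_inj => /=.
have {eq_ij} : forall e, (e < k)%N -> i %/ d ^ e = j %/ d ^ e %[mod d].
  move=> e lt_ek; have lt_l : (k - e.+1 < k)%N by rewrite ltn_subrL (leq_trans _ lt_ek).
  have /(congr1 val) /= := eq_ij (Ordinal lt_l).
  by rewrite -subSn // subSS subKn // ltnW.
move: (nat_of_ord i) (nat_of_ord j) (ltn_ord i) (ltn_ord j) => {i j}.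
elim: k => [|k IHk] x y; first by rewrite expn0 !ltnS !leqn0 => /eqP-> /eqP->.
case: d IHk => [|d] IHk lt_x lt_y eq_xy; first by rewrite exp0n in lt_x.
rewrite (divn_eq x d.+1) (divn_eq y d.+1).
have := eq_xy 0%N isT; rewrite !divn1 => ->; congr (_ * _ + _)%N.
apply: IHk => [||e lt_ek]; rewrite ?ltn_divLR // -?expnSr //.
by rewrite -!divnMA -expnS eq_xy.
Qed.

Lemma tens_perm_tensv (K : comPzRingType) (d k : nat) (s : 'S_k)
    (v : 'I_k -> 'cV[K]_d) :
  tens_perm K d s *m tensv v = tensv (fun l => v (s^-1%g l)).
Proof.
pose F (i : 'I_(d ^ k)) := [ffun l => tens_digit i l].
have F_inj : injective F.
  move=> i j /ffunP eqF; apply: tens_digit_inj => l.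
  by have := eqF l; rewrite !ffunE.
have [G _ GK] : bijective F.
  by apply: inj_card_bij F_inj _; rewrite card_ffun !card_ord.
apply/colP => i; rewrite !mxE.
pose j0 := G [ffun l => tens_digit i (s l)].
have j0E l : tens_digit j0 l = tens_digit i (s l).
  by have /ffunP/(_ l) := GK [ffun l => tens_digit i (s l)]; rewrite !ffunE.
rewrite (bigD1 j0) //= big1 ?addr0 => [|j ne_j].
  rewrite !mxE; have -> : [forall l, tens_digit i l == tens_digit j0 (s^-1%g l)].
    by apply/forallP => l; rewrite j0E permKV.
  rewrite mul1r (reindex_inj (@perm_inj _ s^-1%g)) /=.
  by apply: eq_bigr => l _; rewrite j0E permKV.
rewrite !mxE; case: forallP => [eq_ij|]; last by rewrite mul0r.
case/eqP: ne_j; apply: tens_digit_inj => l.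
by have /eqP := eq_ij (s l); rewrite permK j0E.
Qed.

Definition sym_proj (K : unitRingType) (d k : nat) : 'M[K]_(d ^ k) :=
  (k`!%:R)^-1 *: \sum_(s : 'S_k) tens_perm K d s.

Definition accept_prob (K : unitRingType) (dA dB : nat)
    (psi : 'M[K]_(dA * dB)) (k : nat) : K :=
  \tr (sym_proj K dB k *m ntensmx (ptraceA psi) k).

(* Main.v *)
Require Import Defs.
From mathcomp Require Import all_boot all_order all_algebra all_fingroup.
From mathcomp Require Import spectral ring.
From mathcomp Require Import all_classical all_reals all_analysis.

(* Diagonalising rho_B, p^(k) = h_k(x), the complete homogeneous symmetric polynomial in the
   eigenvalues x of rho_B, written as the average over s in S_k of the sum of x_f = \prod_l x_(f l)
   over the words f with f o s = f.  Every permutation of {0..k} is uniquely s followed by a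
   transposition (0 l) with s fixing 0, and it fixes the word j :: f iff f o s = f and the letter of
   j :: f at l is j; summing over j contributes a factor \sum_j x_j = 1 if l = 0 and x_(f l)
   otherwise.  With mu < 1 the largest eigenvalue this gives (k+1) h_(k+1) <= (1 + k mu) h_k, hence
   strict decrease for k >= 1, and the limit L >= 0 satisfies L <= mu L, so that L = 0. *)

Set Implicit Arguments.
Unset Strict Implicit.
Unset Printing Implicit Defensive.

Import Order.TTheory GRing.Theory Num.Theory.
Local Open Scope classical_set_scope.
Local Open Scope ring_scope.
Local Open Scope complex_scope.

(** * Traces of permutation operators against tensor powers, as sums over words *)

Lemma tens_digits_bij (d k : nat) :
  bijective (fun i : 'I_(d ^ k) => [ffun l => tens_digit i l]).
Proof.
apply: inj_card_bij => [i j /ffunP eq_ij|]; last by rewrite card_ffun !card_ord.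
by apply: tens_digit_inj => l; have := eq_ij l; rewrite !ffunE.
Qed.

Lemma ffun_perm_inj (T : Type) (k : nat) (s : 'S_k) :
  injective (fun f : {ffun 'I_k -> T} => [ffun l => f (s l)]).
Proof.
move=> f g /ffunP eq_fg; apply/ffunP => l.
by have := eq_fg (s^-1%g l); rewrite !ffunE permKV.
Qed.

Lemma trace_tens_perm_ntens (K : comPzRingType) (d k : nat) (s : 'S_k) (A : 'M[K]_d) :
  \tr (tens_perm K d s *m ntensmx A k) =
  \sum_(f : {ffun 'I_k -> 'I_d}) \prod_l A (f (s l)) (f l).
Proof.
pose F (f g : {ffun 'I_k -> 'I_d}) :=
  [forall l, f l == g (s^-1%g l)]%:R * \prod_l A (g l) (f l).
transitivity (\sum_f \sum_g F f g).
  rewrite (reindex _ (onW_bij _ (tens_digits_bij d k))); apply: eq_bigr => i _.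
  rewrite mxE (reindex _ (onW_bij _ (tens_digits_bij d k))).
  apply: eq_bigr => j _; rewrite mxE ntensmxE /F; congr (_%:R * _).
    by congr nat_of_bool; apply: eq_forallb => l; rewrite !ffunE.
  by apply: eq_bigr => l _; rewrite !ffunE.
(* For a fixed column word [g], the permutation matrix keeps only the row word [g] o [s^-1]. *)
rewrite exchange_big [RHS](reindex_inj (@ffun_perm_inj 'I_d k s^-1%g)) /=.
apply: eq_bigr => g _.
rewrite (bigD1 [ffun l => g (s^-1%g l)]) //= big1 ?addr0 => [|f ne_f].
  rewrite /F; have -> /= : [forall l, [ffun l => g (s^-1%g l)] l == g (s^-1%g l)].
    by apply/forallP => l; rewrite ffunE.
  by rewrite mul1r; apply: eq_bigr => l _; rewrite !ffunE permK.
rewrite /F; case: forallP => [eq_fg|]; last by rewrite mul0r.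
by case/eqP: ne_f; apply/ffunP => l; rewrite ffunE; apply/eqP.
Qed.

(** Cyclicity of the trace, combined with the fact that permutation operators commute with k-fold
    tensor powers. In coordinates, the outer and intermediate words swap roles after a shift by [s].
    It serves to cancel the diagonalising matrix. *)
Lemma perm_trace_mulC (K : comPzRingType) (d k : nat) (s : 'S_k) (A B : 'M[K]_d) :
  \sum_(f : {ffun 'I_k -> 'I_d}) \prod_l (A *m B) (f (s l)) (f l) =
  \sum_(f : {ffun 'I_k -> 'I_d}) \prod_l (B *m A) (f (s l)) (f l).
Proof.
have prod_mulmx (M N : 'M[K]_d) (f g : 'I_k -> 'I_d) :
    \prod_l (M *m N) (f l) (g l) =
    \sum_(h : {ffun 'I_k -> 'I_d}) \prod_l (M (f l) (h l) * N (h l) (g l)).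
  rewrite -(bigA_distr_bigA (fun l x => M (f l) x * N x (g l))).
  by apply: eq_bigr => l _; rewrite mxE.
under eq_bigr do rewrite prod_mulmx.
rewrite exchange_big [RHS](reindex_inj (@ffun_perm_inj 'I_d k s^-1%g)) /=.
apply: eq_bigr => g _; rewrite prod_mulmx; apply: eq_bigr => f _.
under [RHS]eq_bigr do rewrite !ffunE permK.
rewrite !big_split /= mulrC; congr (_ * _).
by rewrite [RHS](reindex_inj (@perm_inj _ s)); apply: eq_bigr => l _; rewrite permK.
Qed.

(** The words allowed for [s] are those constant on its cycles, so the inner sum is a product of
    power sums, one per cycle: this is the cycle-index formula for h_k. *)
Definition complete_symm (K : unitRingType) (d k : nat) (x : 'I_d -> K) : K :=
  (k`!%:R)^-1 * \sum_(s : 'S_k)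
    \sum_(f : {ffun 'I_k -> 'I_d} | [forall l, f (s l) == f l]) \prod_l x (f l).

Lemma accept_prob_similar (K : comUnitRingType) (dA dB k : nat)
    (psi : 'M[K]_(dA * dB)) (P : 'M[K]_dB) (x : 'rV[K]_dB) :
  P \in unitmx -> ptraceA psi = invmx P *m diag_mx x *m P ->
  accept_prob psi k = complete_symm k (x 0).
Proof.
move=> P_unit rhoE; rewrite /accept_prob /sym_proj -scalemxAl mxtraceZ.
rewrite mulmx_suml raddf_sum; congr (_ * _); apply: eq_bigr => s _ /=.
rewrite trace_tens_perm_ntens rhoE perm_trace_mulC mulmxA mulmxV // mul1mx.
(* A diagonal matrix kills every word that [s] does not fix. *)
rewrite [RHS]big_mkcond; apply: eq_bigr => f _.
case: forallP => [f_fix|/forallP/forallPn[l ne_l]].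
  by apply: eq_bigr => l _; rewrite mxE f_fix mulr1n (eqP (f_fix l)).
by rewrite (bigD1 l) //= mxE (negbTE ne_l) mulr0n mul0r.
Qed.

(** * The recursion from k to k+1 letters *)

Lemma lift_tperm_bij (k : nat) :
  bijective (fun p : 'I_k.+1 * 'S_k => lift_perm ord0 ord0 p.2 * tperm ord0 p.1)%g.
Proof.
apply: inj_card_bij => [[l s] [m t] /= eq_lm|]; last first.
  by rewrite card_prod !card_Sn card_ord.
(* The product sends 0 to [l], which recovers the transposition; it can then be cancelled on the
   right. *)
have /esym eq_ml : l = m.
  by have /permP/(_ ord0) := eq_lm; rewrite !permM !lift_perm_id !tpermL.
move: eq_lm; rewrite eq_ml => /mulIg/permP eq_st; congr (_, _); apply/permP => i.
by have := eq_st (lift ord0 i); rewrite !lift_perm_lift => /lift_inj.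
Qed.

Definition ffun_cons (T : Type) (k : nat) (p : T * {ffun 'I_k -> T}) :
  {ffun 'I_k.+1 -> T} := [ffun i => oapp p.2 p.1 (unlift ord0 i)].

Lemma ffun_cons0 (T : Type) (k : nat) (p : T * {ffun 'I_k -> T}) :
  ffun_cons p ord0 = p.1.
Proof. by rewrite ffunE unlift_none. Qed.

Lemma ffun_consS (T : Type) (k : nat) (p : T * {ffun 'I_k -> T}) (i : 'I_k) :
  ffun_cons p (lift ord0 i) = p.2 i.
Proof. by rewrite ffunE liftK. Qed.

Lemma ffun_cons_bij (T : Type) (k : nat) : bijective (@ffun_cons T k).
Proof.
exists (fun f : {ffun 'I_k.+1 -> T} => (f ord0, [ffun i => f (lift ord0 i)])) => [[x f]|f].
  by rewrite ffun_cons0; congr (_, _); apply/ffunP => i; rewrite ffunE ffun_consS.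
apply/ffunP => i; case: (unliftP ord0 i) => [j ->|->].
  by rewrite ffun_consS ffunE.
by rewrite ffun_cons0.
Qed.

(* A map fixed by [lift_perm 0 0 s * tperm 0 l] takes the same value at 0 and l, hence is invariant
   under the transposition and fixed by the lift of s as well. *)
Lemma ffun_cons_fixed (T : eqType) (k : nat) (s : 'S_k) (l : 'I_k.+1)
    (p : T * {ffun 'I_k -> T}) :
  [forall i, ffun_cons p ((lift_perm ord0 ord0 s * tperm ord0 l)%g i) == ffun_cons p i] =
  (ffun_cons p l == p.1) && [forall i, p.2 (s i) == p.2 i].
Proof.
have tpermE : ffun_cons p l = p.1 ->
    forall i, ffun_cons p (tperm ord0 l i) = ffun_cons p i.
  by move=> eq_l i; case: tpermP => // ->; rewrite ffun_cons0.
apply/forallP/andP => [fix_p|[/eqP eq_l /forallP fix_p] i].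
  have eq_l : ffun_cons p l = p.1.
    by have /eqP := fix_p ord0; rewrite permM lift_perm_id tpermL ffun_cons0.
  split; first exact/eqP.
  apply/forallP => i; have := fix_p (lift ord0 i).
  by rewrite permM tpermE // lift_perm_lift !ffun_consS.
rewrite permM tpermE //; case: (unliftP ord0 i) => [j ->|->].
  by rewrite lift_perm_lift !ffun_consS.
by rewrite lift_perm_id.
Qed.

Lemma complete_symm_recr (K : numFieldType) (d k : nat) (x : 'I_d -> K) :
  k.+1%:R * complete_symm k.+1 x =
  (k`!%:R)^-1 * \sum_(s : 'S_k)
    \sum_(f : {ffun 'I_k -> 'I_d} | [forall l, f (s l) == f l])
      (\prod_l x (f l)) * (\sum_j x j + \sum_l x (f l)).
Proof.
rewrite /complete_symm factS natrM invfM -!mulrA mulVKf ?pnatr_eq0 //; congr (_ * _).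
rewrite (reindex _ (onW_bij _ (lift_tperm_bij k))).
rewrite -(pair_bigA _ (fun (l : 'I_k.+1) (s : 'S_k) => \sum_(f : {ffun 'I_k.+1 -> 'I_d} |
  [forall i, f ((lift_perm ord0 ord0 s * tperm ord0 l)%g i) == f i]) \prod_i x (f i))).
rewrite exchange_big /=.
apply: eq_bigr => s _.
transitivity (\sum_l \sum_(f : {ffun 'I_k -> 'I_d} | [forall l, f (s l) == f l])
   \sum_(j | ffun_cons (j, f) l == j) x j * \prod_i x (f i)).
  apply: eq_bigr => l _; rewrite (reindex _ (onW_bij _ (@ffun_cons_bij 'I_d k))).
  rewrite [RHS](exchange_big_dep xpredT) //= pair_big_dep /=; apply: eq_big => [[j f]|[j f] _].
    by rewrite ffun_cons_fixed andbC.
  rewrite big_ord_recl ffun_cons0; congr (_ * _).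
  by apply: eq_bigr => i _; rewrite ffun_consS.
rewrite exchange_big; apply: eq_bigr => f _ /=.
(* At [l] = 0 the first letter [j] is free; at a later position it is forced to equal the letter of
   [f] there. *)
rewrite big_ord_recl mulrDr; congr (_ + _).
  by rewrite mulrC mulr_suml; apply: eq_bigl => j; rewrite ffun_cons0 eqxx.
rewrite mulr_sumr; apply: eq_bigr => l _.
rewrite (big_pred1 (f l)) 1?mulrC // => j.
by rewrite ffun_consS eq_sym.
Qed.

(** * The spectrum of the reduced state *)

Lemma adjmxM (C : numClosedFieldType) (m n p : nat) (A : 'M[C]_(m, n)) (B : 'M[C]_(n, p)) :
  adjmx (A *m B) = adjmx B *m adjmx A.
Proof. by rewrite /adjmx trmx_mul map_mxM. Qed.

Lemma adjmxK (C : numClosedFieldType) (m n : nat) (A : 'M[C]_(m, n)) :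
  adjmx (adjmx A) = A.
Proof. by apply/matrixP => i j; rewrite !mxE conjCK. Qed.

(** A Gram matrix is self-adjoint, hence normal and unitarily diagonalisable; each eigenvalue is the
    squared norm of a row of [P *m G]. *)
Lemma gram_spectral (C : numClosedFieldType) (m n : nat) (G : 'M[C]_(n, m)) :
  exists (P : 'M[C]_n) (x : 'rV[C]_n),
    [/\ P *m adjmx P = 1%:M, G *m adjmx G = adjmx P *m diag_mx x *m P
      & forall i, 0 <= x 0 i].
Proof.
set rho := G *m adjmx G.
have rho_adj : adjmx rho = rho by rewrite adjmxM adjmxK.
have rho_normal : rho \is normalmx.
  apply/normalmxP; change (rho *m adjmx rho = adjmx rho *m rho); by rewrite rho_adj.
have [P [x [PPadj rhoE]]] : exists (P : 'M[C]_n) (x : 'rV[C]_n),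
    P *m adjmx P = 1%:M /\ rho = adjmx P *m diag_mx x *m P.
  exists (spectralmx rho), (spectral_diag rho); split.
    exact/unitarymxP/spectral_unitarymx.
  by have /orthomx_spectralP := rho_normal; rewrite invmx_unitary ?spectral_unitarymx.
exists P, x; split=> // i.
have diagE : diag_mx x = (P *m G) *m adjmx (P *m G).
  rewrite adjmxM !mulmxA -[X in _ = X *m _]mulmxA -/rho rhoE !mulmxA PPadj mul1mx.
  by rewrite -mulmxA PPadj mulmx1.
have /matrixP/(_ i i) := diagE; rewrite !mxE eqxx mulr1n => ->.
by apply: sumr_ge0 => j _; rewrite !mxE mul_conjC_ge0.
Qed.

Lemma ptraceA_rank1 (C : numClosedFieldType) (dA dB : nat) (v : 'cV[C]_(dA * dB)) :
  let G := \matrix_(i < dB, a < dA) v (mxtens_index (a, i)) 0 in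
  ptraceA (v *m adjmx v) = G *m adjmx G.
Proof.
move=> G; apply/matrixP => i j; rewrite !mxE; apply: eq_bigr => a _.
by rewrite !mxE big_ord1 !mxE.
Qed.

Lemma mxtrace_ptraceA (K : pzRingType) (dA dB : nat) (M : 'M[K]_(dA * dB)) :
  \tr (ptraceA M) = \tr M.
Proof.
rewrite /mxtrace (reindex (@mxtens_index dA dB)) /=; last first.
  by exists (@mxtens_unindex dA dB) => p _; rewrite (mxtens_indexK, mxtens_unindexK).
rewrite [RHS](eq_bigr (fun p : 'I_dA * 'I_dB =>
  M (mxtens_index (p.1, p.2)) (mxtens_index (p.1, p.2)))) => [|[] //].
rewrite -(pair_bigA _ (fun a i => M (mxtens_index (a, i)) (mxtens_index (a, i)))).
by rewrite exchange_big; apply: eq_bigr => i _; rewrite mxE.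
Qed.

Lemma pure_state_rank1 (C : numClosedFieldType) (n : nat) (P : 'M[C]_n) (i : 'I_n) :
  P *m adjmx P = 1%:M -> pure_state (adjmx P *m delta_mx i i *m P).
Proof.
move=> PPadj; have adj_delta : adjmx (delta_mx i 0 : 'cV[C]_n) = delta_mx 0 i.
  by apply/matrixP => a b; rewrite !mxE rmorph_nat andbC.
exists (adjmx P *m delta_mx i 0); rewrite adjmxM adjmxK adj_delta; split.
  rewrite -mulmxA [P *m _]mulmxA PPadj mul1mx mul_delta_mx.
  by apply/matrixP => a b; rewrite !mxE !ord1.
by rewrite !mulmxA -[X in _ = X *m _]mulmxA mul_delta_mx.
Qed.

(** The eigenvalues are nonnegative with sum 1. If one of them were 1, the others would vanish and
    the reduced state would be a rank-one projection, that is, pure. *)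
Lemma reduced_spectrum (C : numClosedFieldType) (dA dB : nat) (psi : 'M[C]_(dA * dB)) :
  pure_state psi -> ~ pure_state (ptraceA psi) ->
  exists (P : 'M[C]_dB) (x : 'rV[C]_dB),
    [/\ P \in unitmx, ptraceA psi = invmx P *m diag_mx x *m P, \sum_i x 0 i = 1
      & forall i, 0 <= x 0 i < 1].
Proof.
move=> [v [v_unit psiE]] not_pure.
have [P [x [PPadj rhoE x_ge0]]] := gram_spectral
  (\matrix_(i < dB, a < dA) v (mxtens_index (a, i)) 0).
rewrite -ptraceA_rank1 -psiE in rhoE.
have P_unit : P \in unitmx by case: (mulmx1_unit PPadj).
have invP : invmx P = adjmx P by rewrite -[adjmx P]mul1mx -(mulVmx P_unit) -mulmxA PPadj mulmx1.
have sum_x : \sum_i x 0 i = 1.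
  have := mxtrace_ptraceA psi.
  rewrite rhoE mxtrace_mulC mulmxA PPadj mul1mx mxtrace_diag => ->.
  by rewrite psiE mxtrace_mulC v_unit mxtrace1.
exists P, x; rewrite invP; split=> // i; rewrite x_ge0 /=.
have := sum_x; rewrite (bigD1 i) //= => sum_xi.
have rest_ge0 : 0 <= \sum_(j | j != i) x 0 j by apply: sumr_ge0.
rewrite lt_neqAle -[X in _ <= X]sum_xi lerDl rest_ge0 andbT.
apply/eqP => xi1; apply: not_pure.
move: sum_xi; rewrite xi1 -[RHS]addr0 => /addrI/eqP.
rewrite psumr_eq0 // => /allP x0.
rewrite rhoE; suff -> : diag_mx x = delta_mx i i by apply: pure_state_rank1.
apply/matrixP => a b; rewrite !mxE; have [<-|ne_ab] := eqVneq a b.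
  have [->|ne_ai] := eqVneq a i; first by rewrite xi1.
  by have /implyP/(_ ne_ai)/eqP := x0 a (mem_index_enum a).
by rewrite mulr0n; case: (eqVneq a i) => // eq_a; rewrite -eq_a eq_sym (negbTE ne_ab).
Qed.

(** * Positivity and contraction of h_k *)

Lemma complete_symm_gt0 (K : numFieldType) (d k : nat) (x : 'I_d -> K) :
  (forall i, 0 <= x i) -> 0 < \sum_i x i -> 0 < complete_symm k x.
Proof.
move=> x_ge0 sum_x; rewrite mulr_gt0 ?invr_gt0 ?ltr0n ?fact_gt0 //.
(* The identity permutation fixes every word, so it alone contributes the k-th power of the sum of
   [x]. *)
rewrite (bigD1 1%g) //= ltr_wpDr //.
  by do 2!apply: sumr_ge0 => ? _; apply: prodr_ge0.
rewrite (eq_bigl xpredT) => [|f].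
  by rewrite -(bigA_distr_bigA (fun _ => x)) /= prodr_gt0.
by apply/forallP => l; rewrite perm1.
Qed.

Lemma complete_symm_contract (K : numFieldType) (d k : nat) (x : 'I_d -> K) (mu : K) :
  (forall i, 0 <= x i) -> \sum_i x i = 1 -> (forall i, x i <= mu) ->
  k.+1%:R * complete_symm k.+1 x <= (1 + k%:R * mu) * complete_symm k x.
Proof.
move=> x_ge0 sum_x x_le; rewrite complete_symm_recr mulrCA.
rewrite ler_wpM2l ?invr_ge0 ?ler0n // mulr_sumr; apply: ler_sum => s _.
rewrite mulr_sumr; apply: ler_sum => f _.
rewrite mulrC ler_wpM2r ?prodr_ge0 // sum_x lerD2l mulr_natl.
by rewrite -[X in mu *+ X]card_ord -sumr_const ler_sum.
Qed.

Lemma rmorph_complete_symm (K L : fieldType) (g : {rmorphism K -> L}) (d k : nat)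
    (x : 'I_d -> K) :
  g (complete_symm k x) = complete_symm k (fun i => g (x i)).
Proof.
rewrite rmorphM fmorphV rmorph_nat rmorph_sum; congr (_ * _).
apply: eq_bigr => s _; rewrite rmorph_sum; apply: eq_bigr => f _.
by rewrite rmorph_prod.
Qed.

(** * Sequences obeying the contraction inequality *)

Lemma contract_decr (K : numFieldType) (mu : K) (u : nat -> K) (k : nat) :
  mu < 1 -> (0 < k)%N -> 0 < u k -> k.+1%:R * u k.+1 <= (1 + k%:R * mu) * u k ->
  u k.+1 < u k.
Proof.
move=> mu_lt1 k_gt0 uk_gt0 /le_lt_trans le_u.
rewrite -(ltr_pM2l (ltr0Sn K k)); apply: le_u.
by rewrite ltr_pM2r // -[k.+1%:R]natr1 addrC ltrD2r gtr_pMr ?ltr0n.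
Qed.

Lemma contract_cvg0 (R : realType) (mu : R) (u : nat -> R) :
  0 <= mu < 1 -> (forall k, 0 <= u k) ->
  (forall k, k.+1%:R * u k.+1 <= (1 + k%:R * mu) * u k) ->
  u @ \oo --> 0.
Proof.
move=> /andP[mu_ge0 mu_lt1] u_ge0 u_contr.
(* Since [harmonic k] is 1/(k+1), the bracket is (1 + k mu)/(k+1): it is at most 1 and tends to
   [mu]. *)
have contrE k : u k.+1 <= (mu + (1 - mu) * harmonic k) * u k.
  rewrite -(ler_pM2l (ltr0Sn R k)) (le_trans (u_contr k)) // mulrA.
  rewrite mulrDr mulrCA mulfV ?pnatr_eq0 // mulr1 -(natr1 k).
  by rewrite le_eqVlt; apply/orP; left; apply/eqP; congr (_ * _); ring.
have u_cvg : cvgn u.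
  apply: nonincreasing_is_cvgn; last by exists 0 => _ [k _ <-].
  apply/nonincreasing_seqP => k; apply: le_trans (contrE k) _.
  rewrite ler_piMl // -[X in _ <= X](subrK mu) addrC lerD2r ler_piMr ?subr_ge0 ?(ltW mu_lt1) //.
  by rewrite /harmonic invf_le1 ?ltr0n // ler1n.
have u_le : limn u <= mu * limn u.
  have uS : (fun k => u k.+1) @ \oo --> limn u by rewrite cvg_shiftS.
  apply: ler_cvg_to uS _ _; last by apply: nearW => k; exact: contrE.
  apply: cvgM u_cvg; rewrite -[X in _ --> X]addr0; apply: cvgD; first exact: cvg_cst.
  by rewrite -[X in _ --> X](mulr0 (1 - mu)); apply: cvgMr; apply: cvg_harmonic.
suff <- : limn u = 0 by [].
apply/eqP; rewrite eq_le; apply/andP; split.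
  by rewrite leNgt; apply/negP => L_gt0; move: u_le; rewrite leNgt gtr_pMl ?mu_lt1.
by apply: limr_ge => //; apply: nearW.
Qed.

Lemma cvg_real_complex0 (R : realType) (u : nat -> R) :
  u @ \oo --> 0 -> ((fun k => (u k)%:C) : nat -> R[i]^o) @ \oo --> (0 : R[i]^o).
Proof.
move=> /cvgr0Pnorm_lt u0; apply/cvgr0Pnorm_lt => -[e f].
(* A positive complex radius has zero imaginary part, so the real estimate applies. *)
rewrite ltcE /= => /andP[/eqP -> e_gt0].
near=> k; rewrite normc_def /= expr0n /= addr0 sqrtr_sqr ltcR.
by near: k; apply: u0.
Unshelve. all: by end_near. Qed.

Theorem proposition3p2 (R : realType) (dA dB : nat)
    (psi : 'M[R[i]]_(dA * dB)) :
  pure_state psi ->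
  ~ pure_state (ptraceA psi) ->
  (forall k : nat, (1 <= k)%N -> accept_prob psi k.+1 < accept_prob psi k) /\
  (accept_prob psi : nat -> R[i]^o) @ \oo --> (0 : R[i]^o).
Proof.
move=> psi_pure rho_not_pure.
have [P [x [P_unit rhoE sum_x x_lt]]] := reduced_spectrum psi_pure rho_not_pure.
(* The nonnegative eigenvalues are real; passing to [R] makes monotone convergence available. *)
pose r i := complex.Re (x 0 i).
have xE i : x 0 i = (r i)%:C by rewrite RRe_real ?ger0_real //; case/andP: (x_lt i).
have r_ge0 i : 0 <= r i by rewrite -ler0c -xE; case/andP: (x_lt i).
have sum_r : \sum_i r i = 1.
  apply: (@complexI R); rewrite rmorph_sum -[RHS]sum_x.
  by apply: eq_bigr.
(* The default value 0 does not alter the maximum, as all [r i] are nonnegative. *)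
pose mu := \big[Num.max/0]_i r i.
have r_le i : r i <= mu by apply: le_bigmax.
have mu01 : 0 <= mu < 1.
  rewrite bigmax_ge_id /= bigmax_lt // => i _.
  by rewrite -ltcR -xE; case/andP: (x_lt i).
pose h k := complete_symm k r.
have pE : accept_prob psi = (fun k => (h k)%:C).
  apply/funext => k; rewrite (accept_prob_similar k P_unit rhoE) rmorph_complete_symm.
  by congr complete_symm; apply/funext.
have h_gt0 k : 0 < h k by apply: complete_symm_gt0; rewrite ?sum_r.
have h_contr k := complete_symm_contract k r_ge0 sum_r r_le.
have /andP[_ mu_lt1] := mu01.
rewrite pE; split=> [k k_gt0|].
  by rewrite ltcR (contract_decr mu_lt1).
by apply: cvg_real_complex0; apply: (contract_cvg0 mu01) => [k|//]; apply: ltW.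
Qed.
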